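(* Let $\lambda$ be a partition with Frobenius notation $\lambda=(p_1,\ldots,p_N\mid q_1,\ldots,q_N)$. Let $(z_k)_k$ be complex numbers indexed by the contents $k$ of boxes of $\lambda$, with $\Re(z_k)\ge 1$ for all such $k$ and $\Re(z_{p_i})>1$, $\Re(z_{-q_i})>1$ for all $1\le i\le N$, and let ${\pmb s}=(s_{ij})\in T(\lambda,\mathbb{C})$ be given by $s_{ij}=z_{j-i}$. Then $$\zeta_{\lambda}({\pmb s})=\sum_{\sigma\in\mathfrak{S}_N}\mathrm{sgn}(\sigma)\sum_{j_1=0}^{q_1}\cdots\sum_{j_N=0}^{q_N}(-1)^{j_1+\cdots+j_N}\prod_{k=1}^{N}\zeta^{\star}(z_{-j_k},z_{-j_k+1},\ldots,z_{-1},z_0,z_1,\ldots,z_{p_{\sigma(k)}})\prod_{k=1}^{N}\zeta(z_{-j_k-1},z_{-j_k-2},\ldots,z_{-q_k}),$$ where $\mathfrak{S}_N$ is the symmetric group on $\{1,\dots,N\}$ and $\zeta(z_{-j_k-1},\ldots,z_{-q_k})$ is interpreted as $1$ when $j_k=q_k$.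
   Context: Euler–Zagier multiple zeta-function and its star variant: $\zeta(s_1,\ldots,s_r)=\sum_{0<m_1<\cdots<m_r}m_1^{-s_1}\cdots m_r^{-s_r}$, $\zeta^{\star}(s_1,\ldots,s_r)=\sum_{0<m_1\le\cdots\le m_r}m_1^{-s_1}\cdots m_r^{-s_r}$. For a partition $\lambda=(\lambda_1\ge\lambda_2\ge\cdots)$ with conjugate $\lambda'$ ($\lambda'_i=\#\{j:\lambda_j\ge i\}$), let $N$ be the number of boxes on the main diagonal of its Young diagram; the Frobenius notation is $\lambda=(p_1,\ldots,p_N\mid q_1,\ldots,q_N)$ with $p_i=\lambda_i-i$, $q_i=\lambda'_i-i$. $T(\lambda,\mathbb{C})$ is the set of fillings of the Young diagram of $\lambda$ by complex numbers, and $\mathrm{SSYT}(\lambda)$ is the set of fillings $M=(m_{ij})$ by positive integers that weakly increase along rows and strictly increase down columns. The Schur multiple zeta-function is $\zeta_\lambda({\pmb s})=\sum_{M\in\mathrm{SSYT}(\lambda)}\prod_{(i,j)\in\lambda}m_{ij}^{-s_{ij}}$. The content of box $(i,j)$ is $j-i$. *)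

(* Defs.v *)
From HB Require Import structures.
From mathcomp Require Import all_boot all_order all_algebra all_fingroup.
From mathcomp Require Import complex.
From mathcomp Require Import all_classical all_reals all_analysis.
Set Implicit Arguments. Unset Strict Implicit. Unset Printing Implicit Defensive.
Import Order.TTheory GRing.Theory Num.Theory.
Import numFieldTopology.Exports numFieldNormedType.Exports.
Local Open Scope ring_scope.
Local Open Scope complex_scope.

(* topology (metric from the complex modulus) on R[i] *)
HB.instance Definition _ (R : rcfType) :=
  PseudoPointedMetric.copy (complex R) (complex R)^o.

Section SchurZeta.
Variable R : realType.
Local Notation C := R[i].

(* n^{-s} = exp(-s log n) for a positive integer n and s = a + i b:
   n^{-a} (cos (b log n) - i sin (b log n)). *)
Definition npow_neg (n : nat) (s : C) : C :=
  let a := complex.Re s in let b := complex.Im s in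
  let L := ln (n%:R : R) in
  (expR (- a * L) * cos (b * L)) -i* (expR (- a * L) * sin (b * L)).

(* Truncated nested sums, fed with the REVERSED argument list
   (head = last argument s_r, i.e. the outermost / largest index m_r).
   strict = true : 0 < m_1 < ... < m_r <= M
   strict = false: 0 < m_1 <= ... <= m_r <= M *)
Fixpoint mzv_trunc_rev (strict : bool) (rs : seq C) (M : nat) : C :=
  match rs with
  | [::] => 1
  | x :: rs' => \sum_(1 <= m < M.+1)
                  npow_neg m x * mzv_trunc_rev strict rs' (if strict then m.-1 else m)
  end.

Definition mzv (s : seq C) : C := limn (fun M => mzv_trunc_rev true (rev s) M).
Definition mzv_star (s : seq C) : C := limn (fun M => mzv_trunc_rev false (rev s) M).

Definition is_partition (la : seq nat) : bool :=
  sorted (fun x y : nat => (y <= x)%N) la && all (fun x : nat => (0 < x)%N) la.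

(* Boxes are indexed from 0: (i, j) with i < length, j < lambda_{i+1}.
   The content j - i is the same as for 1-indexed coordinates. *)
Definition in_shape (la : seq nat) (i j : nat) : bool := (j < nth 0 la i)%N.

(* conjugate partition: conj la i = lambda'_{i+1} = #{ r : lambda_r >= i+1 } *)
Definition conj_part (la : seq nat) (i : nat) : nat := count (fun x : nat => (i < x)%N) la.

Definition diag_len (la : seq nat) : nat := count (fun i => in_shape la i i) (iota 0 (size la)).

(* Frobenius coordinates, 0-indexed: frob_p la i = p_{i+1}, frob_q la i = q_{i+1} *)
Definition frob_p (la : seq nat) (i : nat) : nat := (nth 0 la i - i.+1)%N.
Definition frob_q (la : seq nat) (i : nat) : nat := (conj_part la i - i.+1)%N.

(* Semistandard Young tableaux of shape la with entries <= M, encoded as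
   functions on the bounding rectangle with value 0 outside the shape. *)
Definition ssyt_le (la : seq nat) (M : nat)
    (T : {ffun 'I_(size la) * 'I_(head 0 la) -> 'I_M.+1}) : bool :=
  [forall i : 'I_(size la), forall j : 'I_(head 0 la),
     (in_shape la i j == (0 < T (i, j))%N)] &&
  [forall i : 'I_(size la), forall j1 : 'I_(head 0 la), forall j2 : 'I_(head 0 la),
     (in_shape la i j2 && (j1 <= j2)%N) ==> (T (i, j1) <= T (i, j2))%N] &&
  [forall i1 : 'I_(size la), forall i2 : 'I_(size la), forall j : 'I_(head 0 la),
     (in_shape la i2 j && (i1 < i2)%N) ==> (T (i1, j) < T (i2, j))%N].

Arguments ssyt_le : clear implicits.

Definition schur_zeta_trunc (la : seq nat) (s : nat -> nat -> C) (M : nat) : C :=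
  \sum_(T : {ffun 'I_(size la) * 'I_(head 0 la) -> 'I_M.+1} | ssyt_le la M T)
    \prod_(ij : 'I_(size la) * 'I_(head 0 la) | in_shape la ij.1 ij.2)
      npow_neg (T ij) (s ij.1 ij.2).

Definition schur_zeta (la : seq nat) (s : nat -> nat -> C) : C :=
  limn (schur_zeta_trunc la s).

End SchurZeta.

(* Main.v *)
(* The identity holds for sums truncated at any level M, where it is the Giambelli
   formula for tableaux whose weights depend on the contents: the sum over tableaux is
   the determinant of the hook sums of arms p_i and legs q_j, and each hook sum is the
   alternating sum over j of star sums times strict sums.  The truncated formula is
   proved by releasing the entry M+1 one content c at a time, in increasing order of c.
   A tableau with a newly allowed entry has it in the removable corner of content c, so
   the tableau sum changes by x times the sum for the shape without that corner.  In
   Frobenius notation, removing it replaces p_k = c by c - 1 (c > 0), or q_k = -c by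
   -c - 1 (c < 0), or drops the last pair (0 | 0) (c = 0); this is what multilinearity
   of the determinant gives, a repeated row or column meaning that there is no corner.
   All the factors on the right converge, hence so does the left-hand side. *)
Require Import Defs.
From HB Require Import structures.
From mathcomp Require Import all_boot all_order all_algebra all_fingroup.
From mathcomp Require Import complex zify ring lra.
From mathcomp Require Import all_classical all_reals all_analysis.
Import Order.TTheory GRing.Theory Num.Theory.
Import numFieldTopology.Exports numFieldNormedType.Exports.
Local Open Scope ring_scope.
Local Open Scope complex_scope.

(** * Alternating sums of star and strict sums *)

Section OrthogonalTrunc.
Variable R : realType.
Local Notation C := R[i].

Lemma mzv_trunc_strictS (x : C) s M :
  mzv_trunc_rev true (x :: s) M.+1 =
  mzv_trunc_rev true (x :: s) M + npow_neg M.+1 x * mzv_trunc_rev true s M.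
Proof. by rewrite /= big_nat_recr. Qed.

Lemma mzv_trunc_starS (x : C) s M :
  mzv_trunc_rev false (x :: s) M.+1 =
  mzv_trunc_rev false (x :: s) M + npow_neg M.+1 x * mzv_trunc_rev false s M.+1.
Proof. by rewrite /= big_nat_recr. Qed.

Lemma mzv_trunc0 b (x : C) s : mzv_trunc_rev b (x :: s) 0 = 0.
Proof. by rewrite /= big_geq. Qed.

(* With bounds [A = B] this is the analogue of [sum_j (-1)^j h_j e_(n-j) = 0]. *)
Let alt A B (l : seq C) := \sum_(0 <= j < (size l).+1)
  (-1) ^+ j * mzv_trunc_rev false (take j l) A * mzv_trunc_rev true (rev (drop j l)) B.

Let alt_cons A B x l : alt A B (x :: l) =
  mzv_trunc_rev true (rev (x :: l)) B
  - \sum_(0 <= j < (size l).+1) (-1) ^+ j * mzv_trunc_rev false (x :: take j l) A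
       * mzv_trunc_rev true (rev (drop j l)) B.
Proof.
rewrite /alt big_nat_recl //= expr0 !mul1r -sumrN; congr (_ + _).
by apply: eq_bigr => j _; rewrite exprS !mulN1r !mulNr.
Qed.

Let alt_rcons A B x l : alt A B (rcons l x) =
  \sum_(0 <= j < (size l).+1) (-1) ^+ j * mzv_trunc_rev false (take j l) A
       * mzv_trunc_rev true (x :: rev (drop j l)) B
  - (-1) ^+ size l * mzv_trunc_rev false (rcons l x) A.
Proof.
rewrite /alt size_rcons big_nat_recr //=; congr (_ + _); last first.
  by rewrite take_oversize ?drop_oversize ?size_rcons //= mulr1 exprS mulN1r mulNr.
rewrite !big_nat; apply: eq_bigr => j /andP[_ jl].
rewrite -cats1 takel_cat // drop_cat cats1; case: ltnP => [_|lj].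
  by rewrite rev_rcons.
have -> : j = size l by apply/eqP; rewrite eqn_leq -ltnS jl lj.
by rewrite subnn drop0 drop_size.
Qed.

(** Induction on [M]: the value [M.+1] is released first in the star factors, then in the strict
    ones. Each release adds a weight times the alternating sum of a list shortened at one end, and
    the two contributions cancel. *)
Lemma star_strict_orthogonal M (l : seq C) :
  \sum_(0 <= j < (size l).+1)
     (-1) ^+ j * mzv_trunc_rev false (take j l) M * mzv_trunc_rev true (rev (drop j l)) M
  = (l == [::])%:R.
Proof.
rewrite -/(alt M M l); elim: M l => [|M IH].
  case=> [|x l]; first by rewrite /alt big_nat1 /= !mulr1.
  rewrite alt_cons.
  have -> : rev (x :: l) = last x l :: rev (belast x l) by rewrite lastI rev_rcons.
  rewrite mzv_trunc0 big1 ?subr0 // => j _.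
  by rewrite mzv_trunc0 mulr0 mul0r.
(* Only the star factors see [M.+1] here. Peeling off the head repeatedly leaves the single term in
   which every index equals [M.+1]. *)
have altSM l : alt M.+1 M l = (-1) ^+ size l * \prod_(x <- l) npow_neg M.+1 x.
  elim: l => [|x l IHl]; first by rewrite /alt big_nat1 big_nil /= !mulr1.
  rewrite alt_cons big_cons -[size (x :: l)]/(size l).+1 exprS.
  under [X in _ - X]eq_bigr do rewrite mzv_trunc_starS mulrDr mulrDl.
  rewrite big_split opprD addrA -alt_cons IH add0r !mulN1r mulNr; congr (- _).
  transitivity (npow_neg M.+1 x * alt M.+1 M l); last by rewrite IHl; ring.
  by rewrite /alt mulr_sumr; apply: eq_bigr => j _; ring.
case/lastP=> [|l x]; first by rewrite /alt big_nat1 /= !mulr1.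
rewrite alt_rcons.
under eq_bigr do rewrite mzv_trunc_strictS mulrDr.
rewrite big_split addrAC -alt_rcons altSM.
transitivity ((-1) ^+ size (rcons l x) * \prod_(y <- rcons l x) npow_neg M.+1 y
  + npow_neg M.+1 x * alt M.+1 M l).
  congr (_ + _); rewrite /alt mulr_sumr; apply: eq_bigr => j _; ring.
rewrite altSM size_rcons -cats1 big_cat big_seq1 /= exprS.
by case: l => [|y l] /=; ring.
Qed.

End OrthogonalTrunc.

(** * Tableau sums and removal of a corner *)

Section Tableaux.
Variables (A : comPzRingType) (w : nat -> int -> A) (n m K : nat).
Local Notation tab := {ffun 'I_n * 'I_m -> 'I_K.+1}.
Implicit Types (D : nat -> nat -> bool) (T : tab).

(** This is [ssyt_le] with an arbitrary shape [D]. The rectangle and the entry bound [K] stay fixed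
    while corners are removed, so that all sums range over one type. *)
Definition semistandard D T :=
  [forall i : 'I_n, forall j : 'I_m, (D i j == (0 < T (i, j))%N)] &&
  [forall i : 'I_n, forall j1 : 'I_m, forall j2 : 'I_m,
     (D i j2 && (j1 <= j2)%N) ==> (T (i, j1) <= T (i, j2))%N] &&
  [forall i1 : 'I_n, forall i2 : 'I_n, forall j : 'I_m,
     (D i2 j && (i1 < i2)%N) ==> (T (i1, j) < T (i2, j))%N].

Lemma semistandardP D T :
  reflect [/\ forall (i : 'I_n) (j : 'I_m), D i j = (0 < T (i, j))%N,
     forall (i : 'I_n) (j1 j2 : 'I_m), D i j2 -> (j1 <= j2)%N -> (T (i, j1) <= T (i, j2))%N &
     forall (i1 i2 : 'I_n) (j : 'I_m), D i2 j -> (i1 < i2)%N -> (T (i1, j) < T (i2, j))%N]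
   (semistandard D T).
Proof.
apply: (iffP andP) => [[/andP[/forallP h1 /forallP h2] /forallP h3]|[h1 h2 h3]]; split.
- by move=> i j; have /forallP/(_ j)/eqP := h1 i.
- move=> i j1 j2 d l; have /forallP/(_ j1)/forallP/(_ j2) := h2 i.
  by rewrite d l.
- move=> i1 i2 j d l; have /forallP/(_ i2)/forallP/(_ j) := h3 i1.
  by rewrite d l.
- apply/andP; split; first by apply/forallP => i; apply/forallP => j; rewrite h1.
  apply/forallP => i; apply/forallP => j1; apply/forallP => j2.
  by apply/implyP => /andP[d l]; exact: h2.
- apply/forallP => i1; apply/forallP => i2; apply/forallP => j.
  by apply/implyP => /andP[d l]; exact: h3.
Qed.

(* The entries [<= M.+1] are released one content at a time, contents running
   from [-n] upwards: stage [t] allows [M.+1] on the contents [< t - n]. *)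
Definition stage_bound (M t i j : nat) : nat := M + (j + n < t + i).

Definition staged M t T := [forall ij : 'I_n * 'I_m, T ij <= stage_bound M t ij.1 ij.2]%N.

Definition tabsum D M t := \sum_(T : tab | semistandard D T && staged M t T)
  \prod_(ij : 'I_n * 'I_m | D ij.1 ij.2) w (T ij) (ij.2%:Z - ij.1%:Z).

Definition young D := forall i j i' j', (i' <= i)%N -> (j' <= j)%N -> D i j -> D i' j'.
Definition boxed D := forall i j, D i j -> (i < n)%N && (j < m)%N.

Definition corner D i j := [&& D i j, ~~ D i.+1 j & ~~ D i j.+1].
Definition remove D i0 j0 := fun i j => D i j && ((i, j) != (i0, j0)).

Lemma staged_le M t T (i : 'I_n) (j : 'I_m) : staged M t T -> (T (i, j) <= stage_bound M t i j)%N.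
Proof. by move/forallP/(_ (i, j)). Qed.

Lemma staged_of_le M t T :
  (forall (i : 'I_n) (j : 'I_m), T (i, j) <= stage_bound M t i j)%N -> staged M t T.
Proof. by move=> h; apply/forallP => -[i j]; exact: h. Qed.

Lemma staged_last M T : staged M (n + m) T = staged M.+1 0 T.
Proof.
apply: eq_forallb => -[i j] /=; rewrite /stage_bound.
have := ltn_ord i; have := ltn_ord j; lia.
Qed.

Lemma eq_tabsum D D' M t : D =2 D' -> tabsum D M t = tabsum D' M t.
Proof.
move=> DD; apply: eq_big => [T|T _]; last by apply: eq_bigl => ij; rewrite DD.
rewrite /semistandard; do ! congr (_ && _);
  by do ! (apply: eq_forallb => ?); rewrite DD.
Qed.

Lemma tabsum_last D M : tabsum D M (n + m) = tabsum D M.+1 0.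
Proof. by apply: eq_bigl => T; rewrite staged_last. Qed.

(** An entry beyond the old bound is [M.+1] and has content [t - n]. A right neighbour would be at
    least [M.+1], but its content is not yet released; a lower neighbour would exceed [M.+1], which
    no stage [t.+1] bound allows. *)
Lemma stagedS_corner D M t T : boxed D -> semistandard D T ->
  staged M t.+1 T -> ~~ staged M t T ->
  exists i : 'I_n, exists2 j : 'I_m, corner D i j & (j + n = t + i)%N /\ T (i, j) = M.+1 :> nat.
Proof.
move=> bD /semistandardP[pos row col] sT; rewrite negb_forall => /existsP[[i j]].
rewrite -ltnNge /= => lt; exists i, j.
  have le := staged_le M t.+1 T i j sT.
  move: lt le; rewrite /stage_bound => lt le.
  have c : (j + n = t + i)%N by lia.
  apply/and3P; split.
  - by rewrite pos; lia.
  - apply/negP => d; have /andP[i1 _] := bD _ _ d.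
    have := col i (Ordinal i1) j d (ltnSn i).
    have := staged_le M t.+1 T (Ordinal i1) j sT; rewrite /stage_bound /=; lia.
  - apply/negP => d; have /andP[_ j1] := bD _ _ d.
    have := row i j (Ordinal j1) d (leqnSn j).
    have := staged_le M t.+1 T i (Ordinal j1) sT; rewrite /stage_bound /=; lia.
have := staged_le M t.+1 T i j sT; move: lt; rewrite /stage_bound => lt le; lia.
Qed.

Lemma stagedW M t T : staged M t T -> staged M t.+1 T.
Proof.
move/forallP => h; apply/forallP => ij; apply: leq_trans (h ij) _.
by rewrite /stage_bound; lia.
Qed.

Lemma tabsum_no_corner D M t : boxed D ->
  (forall i j : nat, corner D i j -> (j + n)%N <> (t + i)%N) ->
  tabsum D M t.+1 = tabsum D M t.
Proof.
move=> bD nc; apply: eq_bigl => T; case ssT: semistandard => //=.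
apply/idP/idP => [sT|]; last exact: stagedW.
apply/negPn/negP => nT; have [i [j cij [e _]]] := stagedS_corner _ _ _ _ bD ssT sT nT.
exact: nc cij e.
Qed.

Definition put T (i0 : 'I_n) (j0 : 'I_m) (v : 'I_K.+1) : tab :=
  [ffun ij => if ij == (i0, j0) then v else T ij].

(** The tableaux gained at stage [t.+1] have [M.+1] in the corner. Resetting that entry to 0, the
    value outside the shape, is a bijection onto the tableaux of the smaller shape at stage [t];
    [M < K] lets [M.+1] be an entry. *)
Lemma tabsum_corner D M t (i0 : 'I_n) (j0 : 'I_m) : young D -> boxed D ->
  (j0 + n = t + i0)%N -> corner D i0 j0 -> (M < K)%N ->
  tabsum D M t.+1 = tabsum D M t
    + w M.+1 (j0%:Z - i0%:Z) * tabsum (remove D i0 j0) M t.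
Proof.
move=> yD bD c0 /and3P[D0 /negP ni /negP nj] MK.
rewrite /tabsum (bigID (fun T : tab => staged M t T)) /=; congr (_ + _).
  apply: eq_bigl => T; rewrite -andbA; congr (_ && _).
  by apply/andP/idP => [[]//|h]; split=> //; exact: stagedW.
pose v : 'I_K.+1 := inord M.+1; have vE : v = M.+1 :> nat by rewrite inordK.
pose h T := put T i0 j0 v; pose h' T := put T i0 j0 ord0.
(* A shape has at most one corner on each diagonal: a box further down the diagonal would force the
   box below the earlier corner into the shape. *)
have top T : semistandard D T -> staged M t.+1 T -> ~~ staged M t T -> T (i0, j0) = v.
  move=> ssT sT nT; have [i [j /and3P[Dij Di Dj] [e eT]]] := stagedS_corner _ _ _ _ bD ssT sT nT.
  have E : i = i0 :> nat.
    have [l|l|//] := ltngtP i i0.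
      by case/negP: Di; apply: yD D0; lia.
    by case: ni; apply: yD Dij; lia.
  apply: val_inj; rewrite [RHS]vE -eT; congr (nat_of_ord (T (_, _))); apply: val_inj => //=; lia.
have hK T : T (i0, j0) = v -> h (h' T) = T.
  by move=> e; apply/ffunP => ij; rewrite !ffunE; case: eqP => // ->.
rewrite (reindex_onto h h') /=; last first.
  by move=> T /andP[/andP[ssT sT] nT]; exact/hK/top.
have h0 T : h T (i0, j0) = v by rewrite ffunE eqxx.
have hn T (i : 'I_n) (j : 'I_m) : (i, j) != (i0, j0) -> h T (i, j) = T (i, j).
  by rewrite ffunE => /negbTE->.
have hh T : (h' (h T) == T) = (T (i0, j0) == ord0).
  apply/eqP/eqP => [<-|e]; first by rewrite ffunE eqxx.
  by apply/ffunP => ij; rewrite !ffunE; case: eqP => // ->.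
have rE (i : 'I_n) (j : 'I_m) : remove D i0 j0 i j = D i j && ((i, j) != (i0, j0)) by [].
rewrite mulr_sumr; apply: eq_big => [T|T /andP[/andP[/andP[ssT sT] nT]]].
  rewrite hh; apply/idP/idP.
    case/andP=> /andP[/andP[/semistandardP[pos row col] sT] nT] /eqP e0.
    apply/andP; split.
      apply/semistandardP; split.
      - move=> i j; rewrite rE; case: (eqVneq (i, j) (i0, j0)) => [[-> ->]|ne].
          by rewrite e0 andbF.
        by rewrite pos hn // andbT.
      - move=> i j1 j2; rewrite rE => /andP[d ne] l; have := row i j1 j2 d l; rewrite [h T (i, j2)]hn //.
        by case: (eqVneq (i, j1) (i0, j0)) => [->|ne1]; rewrite ?e0 // hn.
      - move=> i1 i2 j; rewrite rE => /andP[d ne] l; have := col i1 i2 j d l; rewrite [h T (i2, j)]hn //.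
        case: (eqVneq (i1, j) (i0, j0)) => [[ei ej]|ne1]; last by rewrite hn.
        by case: ni; apply: yD d; [rewrite -ei|rewrite ej].
    apply: staged_of_le => i j; case: (eqVneq (i, j) (i0, j0)) => [->|ne]; first by rewrite e0.
    have := staged_le _ _ _ i j sT; rewrite hn // /stage_bound.
    (* The two stages bound only this diagonal differently. Its other boxes lie strictly north-west
       of the corner, so a row step and then a column step give an entry below [M.+1]. *)
    have [e|] := eqVneq (j + n)%N (t + i)%N; last by lia.
    move=> _; have [Dij|] := boolP (D i j); last first.
      by rewrite pos hn // -leqNgt; lia.
    have li : (i < i0)%N.
      have [//|l|l] := ltngtP i i0.
        by case: ni; apply: yD Dij; lia.
      by case/eqP: ne; congr (_, _); apply: val_inj => //=; lia.
    have lj : (j <= j0)%N by lia.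
    have := row i j j0 (yD _ _ _ _ (ltnW li) (leqnn _) D0) lj.
    have := col i i0 j0 D0 li; rewrite h0 vE [h T (i, j)]hn //; lia.
  case/andP=> /semistandardP[pos row col] sT.
  have bT (i : 'I_n) (j : 'I_m) : (T (i, j) <= stage_bound M t i j)%N := staged_le _ _ _ i j sT.
  have e0 : T (i0, j0) = ord0.
    by apply/val_inj/eqP; rewrite /= -leqn0 leqNgt -pos rE eqxx andbF.
  rewrite e0 eqxx andbT; apply/andP; split; first (apply/andP; split).
  - apply/semistandardP; split.
    + move=> i j; case: (eqVneq (i, j) (i0, j0)) => [[-> ->]|ne]; first by rewrite D0 h0 vE.
      by rewrite hn // -pos rE ne andbT.
    + move=> i j1 j2 d l; case: (eqVneq (i, j2) (i0, j0)) => [E|ne].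
        rewrite E h0 vE; case: (eqVneq (i, j1) (i0, j0)) => [->|ne1]; first by rewrite h0 vE.
        by rewrite hn //; have := bT i j1; rewrite /stage_bound; lia.
      rewrite [h T (i, j2)]hn //; case: (eqVneq (i, j1) (i0, j0)) => [[ei ej]|ne1].
        case: nj; apply: yD d; first by rewrite ei.
        rewrite -ej ltn_neqAle l andbT; apply: contra ne => /eqP/val_inj <-.
        by rewrite ei ej.
      by rewrite hn //; apply: row => //; rewrite rE d.
    + move=> i1 i2 j d l; case: (eqVneq (i1, j) (i0, j0)) => [[ei ej]|ne1].
        by case: ni; apply: yD d; [rewrite -ei|rewrite ej].
      rewrite [h T (i1, j)]hn //; case: (eqVneq (i2, j) (i0, j0)) => [[ei ej]|ne].
        rewrite ei ej h0 vE ltnS; have := bT i1 j0; rewrite /stage_bound.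
        by move: l; rewrite ei; lia.
      by rewrite hn //; apply: col => //; rewrite rE d.
  - apply: staged_of_le => i j; case: (eqVneq (i, j) (i0, j0)) => [[-> ->]|ne].
      by rewrite h0 vE /stage_bound; lia.
    by rewrite hn //; apply: leq_trans (bT i j) _; rewrite /stage_bound; lia.
  - apply/negP => /(staged_le _ _ _ i0 j0); rewrite h0 vE /stage_bound; lia.
rewrite (bigD1 (i0, j0)) //= h0 vE => _; congr (_ * _).
apply: eq_big => [[i j]|[i j] /andP[_ ne]] /=; last by rewrite hn.
by rewrite rE.
Qed.

Lemma tabsum00 D : tabsum D 0 0 =
  ([forall i : 'I_n, forall j : 'I_m, ~~ D i j])%:R.
Proof.
rewrite /tabsum; pose T0 : tab := [ffun=> ord0].
have E T : staged 0 0 T = (T == T0).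
  apply/idP/eqP => [sT|->]; last by apply/forallP => ij; rewrite ffunE.
  apply/ffunP => -[i j]; rewrite ffunE; apply/val_inj => /=.
  have := staged_le _ _ _ i j sT; rewrite /stage_bound; have := ltn_ord i; lia.
case: forallP => [nD|nD].
  rewrite (bigD1 T0) /=.
    rewrite [X in _ + X]big1 ?addr0; last first.
      by move=> T /andP[/andP[_]]; rewrite E => ->.
    by rewrite big1 // => -[i j] /=; have /forallP/(_ j)/negbTE-> := nD i.
  rewrite E eqxx andbT; apply/semistandardP; split.
  - by move=> i j; rewrite ffunE ltnn; have /forallP/(_ j)/negbTE := nD i.
  - by move=> i j1 j2; rewrite !ffunE.
  - by move=> i1 i2 j; have /forallP/(_ j)/negbTE-> := nD i2.
rewrite big1 // => T /andP[/semistandardP[pos _ _]]; rewrite E => /eqP TE; exfalso.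
by apply: nD => i; apply/forallP => j; rewrite pos TE ffunE.
Qed.

End Tableaux.

(** * Shapes in Frobenius notation *)

Section Frobenius.

Definition frob_shape N (p q : nat -> nat) i j :=
  if (i <= j)%N then (i < N)%N && (j <= p i + i)%N else (j < N)%N && (i <= q j + j)%N.

Definition decreasing_upto N (p : nat -> nat) :=
  forall i j, (i < j)%N -> (j < N)%N -> (p j < p i)%N.

Lemma frob_shapeC N p q i j : frob_shape N p q i j = frob_shape N q p j i.
Proof.
rewrite /frob_shape; have [->|ne] := eqVneq i j; first by rewrite leqnn; lia.
case: ifP; case: ifP; lia.
Qed.

Lemma frob_shape_diag N p q i : frob_shape N p q i i = (i < N)%N.
Proof. by rewrite /frob_shape leqnn leq_addl andbT. Qed.

Lemma frob_shape_arm N p q i c : frob_shape N p q i (i + c) = (i < N)%N && (c <= p i)%N.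
Proof. by rewrite /frob_shape leq_addr addnC leq_add2r. Qed.

(** [p i + i] is the last column of row [i], so strictly decreasing arms correspond to weakly
    decreasing row lengths. *)
Lemma decreasing_upto_add N p : decreasing_upto N p ->
  forall i j, (i <= j)%N -> (j < N)%N -> (p j + j <= p i + i)%N.
Proof.
move=> dp i j ij jN; elim: j ij jN => [|j IH]; first by rewrite leqn0 => /eqP->.
rewrite leq_eqVlt => /orP[/eqP->//|ij] jN; have := IH ij (ltnW jN).
have := dp j j.+1 (ltnSn _) jN; lia.
Qed.

(** A move within one arm, or one leg after transposition, is [half]. Every other move changes the
    arm or leg being tested, and [decreasing_upto_add] compares the two. *)
Lemma young_frob_shape N p q : decreasing_upto N p -> decreasing_upto N q ->
  young (frob_shape N p q).
Proof.
have half p' q' i j j' : decreasing_upto N p' -> (i <= j)%N -> (j <= j')%N ->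
    frob_shape N p' q' i j' -> frob_shape N p' q' i j.
  by move=> dp ij jj'; rewrite /frob_shape ij (leq_trans ij jj'); lia.
move=> dp dq.
have row i j j' : (j <= j')%N -> frob_shape N p q i j' -> frob_shape N p q i j.
  move=> jj'; have [ij|ji] := leqP i j; first exact: half.
  have [ij'|ji'] := leqP i j'; rewrite /frob_shape.
    rewrite ij' (leqNgt i j) ji /= => /andP[iN _].
    have := decreasing_upto_add _ _ dq j i (ltnW ji) iN; lia.
  rewrite (leqNgt i j) ji (leqNgt i j') ji' /= => /andP[jN l].
  have := decreasing_upto_add _ _ dq j j' jj' jN; lia.
have col i i' j : (i <= i')%N -> frob_shape N p q i' j -> frob_shape N p q i j.
  move=> ii'; have [ij|ji] := leqP i j; last first.
    by rewrite !(frob_shapeC N p q); apply: half => //; exact: ltnW.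
  have [ij'|ji'] := leqP i' j; rewrite /frob_shape.
    rewrite ij' ij /= => /andP[iN l].
    have := decreasing_upto_add _ _ dp i i' ii' iN; lia.
  rewrite ij (leqNgt i' j) ji' /= => /andP[jN _].
  have := decreasing_upto_add _ _ dp i j ij jN; lia.
by move=> i j i' j' li lj /(row _ _ _ lj) /(col _ _ _ li).
Qed.

Lemma boxed_frob_shape n m N p q : decreasing_upto N p -> decreasing_upto N q ->
  (forall i, (i < N)%N -> (p i + i < m)%N && (q i + i < n)%N) -> boxed n m (frob_shape N p q).
Proof.
move=> dp dq b i j; rewrite /frob_shape; case: ifP => ij /andP[iN l].
- have /andP[pm qn] := b i iN; lia.
- have /andP[pm qn] := b j iN; lia.
Qed.

Definition set_at (p : nat -> nat) k v := fun i => if i == k then v else p i.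

(** The box below is [(i.+1, i.+1 + c)], present exactly when [c <= p i.+1]. Since
    [p i.+1 < p i = c.+1], this means equality. *)
Lemma frob_corner_arm N p q i c : decreasing_upto N p ->
  corner (frob_shape N p q) i (i + c.+1) =
  [&& (i < N)%N, p i == c.+1 & (i.+1 < N)%N ==> (p i.+1 != c)].
Proof.
move=> dp; rewrite /corner -addnS frob_shape_arm frob_shape_arm -addSnnS frob_shape_arm.
have := dp i i.+1 (ltnSn i); case: (ltnP i.+1 N) => iN /=; last by lia.
by move/(_ isT); lia.
Qed.

Lemma frob_shape_set_arm N p q k c : p k = c.+1 -> (k < N)%N ->
  frob_shape N (set_at p k c) q =2 remove (frob_shape N p q) k (k + c.+1).
Proof.
move=> pk kN i j; rewrite /remove xpair_eqE /frob_shape /set_at.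
case: (eqVneq i k) => [->|ik]; case: ifP; rewrite ?pk; lia.
Qed.

Lemma frob_shape_pop N p q : p N = 0%N -> q N = 0%N ->
  frob_shape N p q =2 remove (frob_shape N.+1 p q) N N.
Proof.
move=> p0 q0 i j; rewrite /remove xpair_eqE /frob_shape.
have [->|iN] := eqVneq i N; have [->|jN] := eqVneq j N; rewrite ?p0 ?q0; case: ifP; lia.
Qed.

Lemma frob_corner_diag N p q i :
  corner (frob_shape N p q) i i = [&& (i < N)%N, p i == 0%N & q i == 0%N].
Proof.
rewrite /corner frob_shape_diag frob_shapeC -addn1 !frob_shape_arm; lia.
Qed.

Lemma decreasing_upto_set N p k c : decreasing_upto N p -> p k = c.+1 ->
  ((k.+1 < N)%N ==> (p k.+1 != c)) -> decreasing_upto N (set_at p k c).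
Proof.
move=> dp pk kN i j ij jN; rewrite /set_at; have := dp i j ij jN; move: ij jN.
have [->|ik] := eqVneq i k; have [->|jk] := eqVneq j k; rewrite ?pk; try lia.
have [->|kj] := eqVneq j k.+1; first by move: kN; lia.
move=> kj' jN; have := dp k.+1 j; have := dp k k.+1 (ltnSn k); rewrite pk; lia.
Qed.
End Frobenius.

(** * The Giambelli determinant *)

Section Giambelli.
Variable A : comPzRingType.

Lemma det_row_addZ N (k : 'I_N) (B C : 'M[A]_N) (x : A) (r : 'I_N -> A) :
  (forall i j, i != k -> C i j = B i j) ->
  (forall j, C k j = B k j + x * r j) ->
  \det C = \det B + x * \det (\matrix_(i, j) (if i == k then r j else B i j)).
Proof.
move=> Ci Ck; rewrite -[X in X + _]mul1r; apply: (@determinant_multilinear _ _ _ _ _ k).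
- by apply/rowP => j; rewrite !mxE eqxx mul1r Ck.
- by apply/matrixP => i j; rewrite !mxE Ci // eq_sym neq_lift.
- by apply/matrixP => i j; rewrite !mxE Ci eq_sym ?(negbTE (neq_lift _ _)).
Qed.

Lemma det_col_addZ N (k : 'I_N) (B C : 'M[A]_N) (x : A) (r : 'I_N -> A) :
  (forall i j, j != k -> C i j = B i j) ->
  (forall i, C i k = B i k + x * r i) ->
  \det C = \det B + x * \det (\matrix_(i, j) (if j == k then r i else B i j)).
Proof.
move=> Cj Ck; rewrite -det_tr -[in RHS]det_tr (det_row_addZ _ k B^T C^T x r).
- congr (_ + _ * _); rewrite -[RHS]det_tr; congr determinant.
  by apply/matrixP => i j; rewrite !mxE.
- by move=> i j ik; rewrite !mxE Cj.
- by move=> j; rewrite !mxE Ck.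
Qed.

Lemma det_last_row_delta N (B : 'M[A]_N.+1) :
  (forall j, B ord_max j = (j == ord_max)%:R) ->
  \det B = \det (\matrix_(i < N, j < N) B (widen_ord (leqnSn N) i) (widen_ord (leqnSn N) j)).
Proof.
move=> Bm; rewrite (expand_det_row _ ord_max) (bigD1 ord_max) //= big1 ?addr0; last first.
  by move=> j jm; rewrite Bm (negbTE jm) mul0r.
rewrite Bm eqxx mul1r /cofactor addnn -mul2n exprM sqrrN expr1n expr1n mul1r.
congr determinant; apply/matrixP => i j; rewrite !mxE.
by congr (B _ _); apply: val_inj; rewrite /= /bump leqNgt ltn_ord.
Qed.


(** [H M t p q] plays the staged sum of the hook [(p | q)], and the hypotheses are its corner
    removals. For [q = 0] and [p > 0] the diagonal box is no corner, hence the disjunction in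
    [H_same]; in [H_diag] the removal leaves the empty shape, whose sum is 1. *)
Variables (w : nat -> int -> A) (n m K : nat) (H : nat -> nat -> nat -> nat -> A).
Hypothesis H00 : forall p q, H 0 0 p q = 0.
Hypothesis H_last : forall M p q, (p < m)%N -> (q < n)%N -> H M (n + m) p q = H M.+1 0 p q.
Hypothesis H_same : forall M t p q, t <> (n + p)%N -> (t + q)%N <> n \/ q = 0%N ->
  H M t.+1 p q = H M t p q.
Hypothesis H_arm : forall M p q,
  H M (n + p.+1).+1 p.+1 q = H M (n + p.+1) p.+1 q + w M.+1 p.+1%:Z * H M (n + p.+1) p q.
Hypothesis H_leg : forall M t p q, (t + q.+1)%N = n ->
  H M t.+1 p q.+1 = H M t p q.+1 + w M.+1 (- q.+1%:Z) * H M t p q.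
Hypothesis H_diag : forall M q, H M n.+1 0 q = H M n 0 q + w M.+1 0 * (q == 0%N)%:R.

Let F N p q := tabsum A w n m K (frob_shape N p q).
Let G N (p q : nat -> nat) M t := \det (\matrix_(i < N, j < N) H M t (p i) (q j)).
Let admissible N p q := [/\ decreasing_upto N p, decreasing_upto N q &
  forall i, (i < N)%N -> (p i + i < m)%N && (q i + i < n)%N].

(** At most one row of the matrix, the one with arm [c.+1], changes, and it changes by a multiple of
    the row of arm [c]. *)
Let step_arm M c N p q : admissible N p q -> (n + c.+1 < n + m)%N -> (M < K)%N ->
  (forall N p q, admissible N p q -> F N p q M (n + c.+1) = G N p q M (n + c.+1)) ->
  F N p q M (n + c.+1).+1 = G N p q M (n + c.+1).+1.
Proof.
move=> adm cm MK IH; have [dp dq b] := adm.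
have yD := young_frob_shape N p q dp dq; have bD := boxed_frob_shape n m N p q dp dq b.
have same i q' : p i != c.+1 -> H M (n + c.+1).+1 (p i) q' = H M (n + c.+1) (p i) q'.
  by move=> /eqP pi; apply: H_same; lia.
case: (pickP (fun k : 'I_N => p k == c.+1)) => [k /eqP pk|nk]; last first.
  rewrite /F tabsum_no_corner //; last first.
    move=> i j cij e; move: cij; have -> : j = (i + c.+1)%N by lia.
    rewrite frob_corner_arm // => /and3P[iN pi _].
    by have := nk (Ordinal iN); rewrite pi.
  rewrite -/(F N p q) IH // /G; congr determinant; apply/matrixP => i j; rewrite !mxE same //.
  by rewrite nk.
have ne i : i != k -> p i != c.+1.
  move=> ik; have : (i != k :> nat) by [].
  rewrite neq_ltn => /orP[l|l]; first by have := dp i k l (ltn_ord k); lia.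
  by have := dp k i l (ltn_ord i); lia.
rewrite /G (det_row_addZ _ k (\matrix_(i, j) H M (n + c.+1) (p i) (q j)) _ (w M.+1 c.+1%:Z)
  (fun j => H M (n + c.+1) c (q j))); first last.
- by move=> j; rewrite !mxE pk H_arm.
- by move=> i j ik; rewrite !mxE same // ne.
rewrite -/(G N p q _ _) -IH //.
have set_matrix : \matrix_(i, j) (if i == k then H M (n + c.+1) c (q j) else
    (\matrix_(i, j) H M (n + c.+1) (p i) (q j)) i j) =
    \matrix_(i < N, j < N) H M (n + c.+1) (set_at p k c i) (q j).
  by apply/matrixP => i j; rewrite !mxE /set_at -val_eqE; case: ifP.
rewrite {}set_matrix -/(G N (set_at p k c) q _ _).
(* The same condition decides both sides: if the next arm is not [c], the corner exists and the
   second determinant is that of the smaller shape; if it is [c], there is no corner and the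
   determinant has two equal rows. *)
case e: ((k.+1 < N)%N ==> (p k.+1 != c)).
  have ck : corner (frob_shape N p q) k (k + c.+1) by rewrite frob_corner_arm // ltn_ord pk eqxx.
  have /andP[kn km] := bD _ _ (proj1 (andP ck)).
  rewrite /F (tabsum_corner _ _ _ _ _ _ _ _ (Ordinal kn) (Ordinal km)) //=; last by lia.
  rewrite -IH; last first.
    split=> //; first exact: decreasing_upto_set.
    move=> i iN; have := b i iN; rewrite /set_at; case: eqP => [->|//]; rewrite pk; lia.
  congr (_ + w _ _ * _); first by rewrite PoszD addrC addKr.
  by apply: eq_tabsum => i j; rewrite (frob_shape_set_arm _ _ _ _ _ pk).
move: e => /negbT; rewrite negb_imply negbK => /andP[kN /eqP pk1].
rewrite /F tabsum_no_corner //; last first.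
  move=> i j cij eij; move: cij; have -> : j = (i + c.+1)%N by lia.
  rewrite frob_corner_arm // => /and3P[iN pi].
  have -> : i = k.
    apply/eqP/negPn/negP => ik; have := ne (Ordinal iN); rewrite -val_eqE /= ik pi.
    by move/(_ isT).
  by rewrite kN pk1 eqxx.
rewrite [G _ (set_at _ _ _) _ _ _](@determinant_alternate _ _ _ k (Ordinal kN)) ?mulr0 ?addr0 //.
- by rewrite -val_eqE /= neq_ltn ltnSn.
- move=> j; rewrite !mxE /set_at eqxx /= pk1.
  by rewrite gtn_eqF.
Qed.

(** The transpose of [step_arm]: a column changes instead of a row, and [cornerC] carries the arm
    lemmas over to legs. *)
Let step_leg M c t N p q : admissible N p q -> (t + c.+1)%N = n -> (M < K)%N ->
  (forall N p q, admissible N p q -> F N p q M t = G N p q M t) ->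
  F N p q M t.+1 = G N p q M t.+1.
Proof.
move=> adm tc MK IH; have [dp dq b] := adm.
have yD := young_frob_shape N p q dp dq; have bD := boxed_frob_shape n m N p q dp dq b.
have cornerC i j : corner (frob_shape N p q) i j = corner (frob_shape N q p) j i.
  by rewrite /corner !(frob_shapeC N p q) [_ && ~~ _]andbC.
have same i p' : q i != c.+1 -> H M t.+1 p' (q i) = H M t p' (q i).
  by move=> /eqP qi; apply: H_same; lia.
case: (pickP (fun k : 'I_N => q k == c.+1)) => [k /eqP qk|nk]; last first.
  rewrite /F tabsum_no_corner //; last first.
    move=> i j; rewrite cornerC => cij e; move: cij; have -> : i = (j + c.+1)%N by lia.
    rewrite frob_corner_arm // => /and3P[jN qj _].
    by have := nk (Ordinal jN); rewrite qj.
  rewrite -/(F N p q) IH // /G; congr determinant; apply/matrixP => i j; rewrite !mxE same //.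
  by rewrite nk.
have ne i : i != k -> q i != c.+1.
  move=> ik; have : (i != k :> nat) by [].
  rewrite neq_ltn => /orP[l|l]; first by have := dq i k l (ltn_ord k); lia.
  by have := dq k i l (ltn_ord i); lia.
rewrite /G (det_col_addZ _ k (\matrix_(i, j) H M t (p i) (q j)) _ (w M.+1 (- c.+1%:Z))
  (fun i => H M t (p i) c)); first last.
- by move=> i; rewrite !mxE qk H_leg.
- by move=> i j jk; rewrite !mxE same // ne.
rewrite -/(G N p q _ _) -IH //.
have set_matrix : \matrix_(i, j) (if j == k then H M t (p i) c else
    (\matrix_(i, j) H M t (p i) (q j)) i j) =
    \matrix_(i < N, j < N) H M t (p i) (set_at q k c j).
  by apply/matrixP => i j; rewrite !mxE /set_at -val_eqE; case: ifP.
rewrite {}set_matrix -/(G N p (set_at q k c) _ _).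
case e: ((k.+1 < N)%N ==> (q k.+1 != c)).
  have ck : corner (frob_shape N p q) (k + c.+1) k.
    by rewrite cornerC frob_corner_arm // ltn_ord qk eqxx.
  have /andP[kn km] := bD _ _ (proj1 (andP ck)).
  rewrite /F (tabsum_corner _ _ _ _ _ _ _ _ (Ordinal kn) (Ordinal km)) //=; last by lia.
  rewrite -IH; last first.
    split=> //; first exact: decreasing_upto_set.
    move=> i iN; have := b i iN; rewrite /set_at; case: eqP => [->|//]; rewrite qk; lia.
  congr (_ + w _ _ * _); first by rewrite PoszD opprD addNKr.
  apply: eq_tabsum => i j; rewrite frob_shapeC (frob_shape_set_arm _ _ _ _ _ qk) //.
  by rewrite /remove frob_shapeC !xpair_eqE [(j == _) && _]andbC.
move: e => /negbT; rewrite negb_imply negbK => /andP[kN /eqP qk1].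
rewrite /F tabsum_no_corner //; last first.
  move=> i j; rewrite cornerC => cij eij; move: cij; have -> : i = (j + c.+1)%N by lia.
  rewrite frob_corner_arm // => /and3P[jN qj].
  have -> : j = k.
    apply/eqP/negPn/negP => jk; have := ne (Ordinal jN); rewrite -val_eqE /= jk qj.
    by move/(_ isT).
  by rewrite kN qk1 eqxx.
rewrite [G _ _ (set_at _ _ _) _ _]/G -det_tr.
rewrite (@determinant_alternate _ _ _ k (Ordinal kN)) ?mulr0 ?addr0 //.
- by rewrite -val_eqE /= neq_ltn ltnSn.
- move=> j; rewrite !mxE /set_at eqxx /= qk1.
  by rewrite gtn_eqF.
Qed.

(** The entry at [(i, j)] changes only if [p i] and [q j] both vanish, which strict decrease allows
    only in the last row and column. The correction replaces the last row by a unit vector, so its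
    determinant is that of the matrix without the last pair. *)
Let step_diag M N p q : admissible N p q -> (M < K)%N ->
  (forall N p q, admissible N p q -> F N p q M n = G N p q M n) ->
  F N p q M n.+1 = G N p q M n.+1.
Proof.
move=> adm MK IH; have [dp dq b] := adm.
have yD := young_frob_shape N p q dp dq; have bD := boxed_frob_shape n m N p q dp dq b.
have same p' q' : p' != 0%N \/ q' != 0%N -> H M n.+1 p' q' = H M n p' q'.
  case: p' => [|p']; last by move=> _; apply: H_same; lia.
  by case=> // q0; rewrite H_diag (negbTE q0) mulr0 addr0.
have nz i : (i.+1 < N)%N -> (p i != 0%N) && (q i != 0%N).
  by move=> iN; have := dp i i.+1 (ltnSn _) iN; have := dq i i.+1 (ltnSn _) iN; lia.
have no_change : (forall i, (i < N)%N -> (p i != 0%N) || (q i != 0%N)) ->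
    F N p q M n.+1 = G N p q M n.+1.
  move=> nz'; rewrite /F tabsum_no_corner //; last first.
    move=> i j cij /eqP; rewrite addnC eqn_add2l => /eqP ji; move: cij.
    rewrite ji frob_corner_diag => /and3P[iN pi qi].
    by have := nz' i iN; rewrite pi qi.
  rewrite -/(F N p q) IH // /G; congr determinant; apply/matrixP => i j; rewrite !mxE same //.
  have [<-|] := eqVneq i j; first by apply/orP/nz'.
  rewrite -val_eqE /= neq_ltn => /orP[l|l]; [left|right].
    by have := dp i j l (ltn_ord j); lia.
  by have := dq j i l (ltn_ord i); lia.
case: N adm dp dq b yD bD nz no_change => [|N] adm dp dq b yD bD nz no_change.
  exact: no_change.
case: (eqVneq (p N) 0%N) => [pN|pN]; last first.
  apply: no_change => i; rewrite ltnS leq_eqVlt => /orP[/eqP->|iN]; first by rewrite pN.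
  by have /andP[->] := nz i iN.
case: (eqVneq (q N) 0%N) => [qN|qN]; last first.
  apply: no_change => i; rewrite ltnS leq_eqVlt => /orP[/eqP->|iN]; first by rewrite qN orbT.
  by have /andP[->] := nz i iN.
rewrite /G (det_row_addZ _ ord_max (\matrix_(i, j) H M n (p i) (q j)) _ (w M.+1 0)
  (fun j => (j == ord_max)%:R)); first last.
- move=> j; rewrite !mxE /= pN H_diag -val_eqE /=; congr (_ + _ * (nat_of_bool _)%:R).
  apply/eqP/eqP => [qj|->//]; apply/eqP; rewrite eqn_leq -ltnS ltn_ord leqNgt.
  by apply/negP => jN; have := nz j jN; rewrite qj andbF.
- move=> i j iN; rewrite !mxE same //; left.
  have : (i.+1 < N.+1)%N by rewrite ltnS ltn_neqAle -ltnS ltn_ord andbT.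
  by move/nz => /andP[].
rewrite -/(G N.+1 p q _ _) -IH // det_last_row_delta; last by move=> j; rewrite !mxE eqxx.
have -> : \matrix_(i < N, j < N) (\matrix_(i, j) (if i == ord_max then (j == ord_max)%:R
    else (\matrix_(i, j) H M n (p i) (q j)) i j)) (widen_ord (leqnSn N) i)
    (widen_ord (leqnSn N) j) = \matrix_(i < N, j < N) H M n (p i) (q j).
  by apply/matrixP => i j; rewrite !mxE -val_eqE /= (ltn_eqF (ltn_ord i)).
have cN : corner (frob_shape N.+1 p q) N N by rewrite frob_corner_diag ltnSn pN qN.
have /andP[Nn Nm] := bD _ _ (proj1 (andP cN)).
rewrite /F (tabsum_corner _ _ _ _ _ _ _ _ (Ordinal Nn) (Ordinal Nm)) //=; last by lia.
rewrite -/(G N p q _ _) -IH; last first.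
  split.
  - by move=> i j ij jN; apply: dp; lia.
  - by move=> i j ij jN; apply: dq; lia.
  - by move=> i iN; apply: b; lia.
congr (_ + w _ _ * _); first by rewrite subrr.
by apply: eq_tabsum => i j; rewrite (frob_shape_pop _ _ _ pN qN).
Qed.

(** Induction on [M], and inside it on the stage, for all shapes at once because each step may refer
    to a smaller shape. The sign of the content [t - n] selects the step. *)
Lemma staged_giambelli M N p q : (M <= K)%N ->
  decreasing_upto N p -> decreasing_upto N q ->
  (forall i, (i < N)%N -> (p i + i < m)%N && (q i + i < n)%N) ->
  tabsum A w n m K (frob_shape N p q) M 0 = \det (\matrix_(i < N, j < N) H M 0 (p i) (q j)).
Proof.
move=> MK dp dq b; have {dp dq b} adm : admissible N p q by [].
rewrite -/(F N p q _ _) -/(G N p q _ _).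
elim: M MK N p q adm => [|M IH] MK N p q adm; have [dp dq b] := adm.
  (* Without positive entries only the empty shape has a tableau, matching the empty determinant 1;
     otherwise the matrix is zero. *)
  rewrite /F /G tabsum00; case: N dp dq b {adm} => [|N] dp dq b.
    rewrite det_mx00; case: forallP => // -[] i; apply/forallP => j.
    by rewrite /frob_shape; case: ifP.
  have -> : \matrix_(i < N.+1, j < N.+1) H 0 0 (p i) (q j) = 0.
    by apply/matrixP => i j; rewrite !mxE H00.
  rewrite det0; have /andP[pm qn] := b 0%N isT.
  have n0 : (0 < n)%N by lia.
  have m0 : (0 < m)%N by lia.
  case: forallP => // /(_ (Ordinal n0))/forallP/(_ (Ordinal m0)).
  by [].
rewrite /F -tabsum_last -/(F N p q).
have -> : G N p q M.+1 0 = G N p q M (n + m).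
  rewrite /G; congr determinant; apply/matrixP => i j; rewrite !mxE H_last //.
    by have := b i (ltn_ord i); lia.
  by have := b j (ltn_ord j); lia.
suff stage t : (t <= n + m)%N -> forall N p q, admissible N p q -> F N p q M t = G N p q M t.
  exact: stage.
elim: t => [|t IHt] tnm N' p' q' adm'; first by apply: IH => //; exact: ltnW.
have IH' := IHt (ltnW tnm).
case: (ltngtP t n) => [tn|nt|tn].
- by apply: (step_leg M (n - t.+1)) => //; lia.
- have tE : t = (n + (t - n.+1).+1)%N by lia.
  by move: IH' tnm; rewrite tE => IH' tnm; apply: step_arm => //; lia.
- by move: IH'; rewrite tn => IH'; exact: step_diag.
Qed.

End Giambelli.

(** * Hook sums and the truncated identity *)

#[local] Arguments mzv_trunc_rev : simpl never.

Section Hook.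
Variables (R : realType) (z : int -> R[i]) (n m : nat).

(** [arm_seq p j] is [z_{-j}, ..., z_p] and [leg_seq q j] is [z_{-j-1}, ..., z_{-q}]: the argument
    lists of the star and strict factors. *)
Definition arm_seq p j := [seq z (x%:Z - j%:Z) | x <- iota 0 (j + p).+1].
Definition leg_seq q j := [seq z (- x%:Z) | x <- iota j.+1 (q - j)].

#[local] Arguments arm_seq : simpl never.
#[local] Arguments leg_seq : simpl never.

Lemma rev_arm_seqS p j : rev (arm_seq p.+1 j) = z p.+1%:Z :: rev (arm_seq p j).
Proof.
rewrite /arm_seq addnS -(addn1 (j + p).+1) iotaD add0n map_cat rev_cat /=.
by congr (z _ :: _); rewrite -addnS PoszD addrC addKr.
Qed.

(** Behind [z 0] stands the prefix of length [j] of [z_{-1}, z_{-2}, ...], while [leg_seq q j] is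
    what remains of that list up to [z_{-q}]. This is the shape needed for
    [star_strict_orthogonal]. *)
Lemma rev_arm_seq0 j : rev (arm_seq 0 j) = z 0 :: [seq z (- x%:Z) | x <- iota 1 j].
Proof.
rewrite /arm_seq addn0 -(addn1 j) iotaD add0n map_cat rev_cat /=.
rewrite subrr; congr (_ :: _); elim: j => // j IH.
rewrite -[in RHS](addn1 j) iotaD map_cat -IH /= rev_cons cats1 add1n sub0r; congr (rcons (rev _) _).
rewrite (iotaDl 1 0) -map_comp; apply: eq_map => x /=.
by congr z; lia.
Qed.

Lemma rev_leg_seqS q j : (j <= q)%N -> rev (leg_seq q.+1 j) = z (- q.+1%:Z) :: rev (leg_seq q j).
Proof.
move=> jq; rewrite /leg_seq subSn // -(addn1 (q - j)) iotaD map_cat rev_cat /=.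
by rewrite addSn subnKC.
Qed.

Lemma leg_seqnn q : leg_seq q q = [::].
Proof. by rewrite /leg_seq subnn. Qed.

(* The bounds are those of stage [t] for the contents [p] and [-q]; the bounds on the other
   contents then follow from the inequalities between the summation indices. *)
Definition hook_stage M t p q := \sum_(0 <= j < q.+1)
  (-1) ^+ j * mzv_trunc_rev false (rev (arm_seq p j)) (M + (p + n < t)%N)
  * mzv_trunc_rev true (rev (leg_seq q j)) (M + (n < t + q)%N).

Lemma hook_stage00 p q : hook_stage 0 0 p q = 0.
Proof.
rewrite /hook_stage big1 // => j _.
by case: p => [|p]; rewrite ?rev_arm_seqS ?rev_arm_seq0 mzv_trunc0 mulr0 mul0r.
Qed.

Lemma hook_stage_last M p q : (p < m)%N -> (q < n)%N ->
  hook_stage M (n + m) p q = hook_stage M.+1 0 p q.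
Proof.
move=> pm qn; rewrite /hook_stage; apply: eq_bigr => j _.
by congr (_ * mzv_trunc_rev _ _ _ * mzv_trunc_rev _ _ _); lia.
Qed.

Lemma hook_stage_same M t p q : t <> (n + p)%N -> (t + q)%N <> n \/ q = 0%N ->
  hook_stage M t.+1 p q = hook_stage M t p q.
Proof.
move=> tp tq; have -> : hook_stage M t.+1 p q = \sum_(0 <= j < q.+1)
  (-1) ^+ j * mzv_trunc_rev false (rev (arm_seq p j)) (M + (p + n < t)%N)
  * mzv_trunc_rev true (rev (leg_seq q j)) (M + (n < t.+1 + q)%N).
  apply: eq_bigr => j _.
  by congr (_ * mzv_trunc_rev _ _ _ * _); lia.
(* For [q = 0] the only strict factor has an empty list, so its bound does not matter. *)
case: tq => [tq|->]; last by rewrite /hook_stage !big_nat1.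
by apply: eq_bigr => j _; congr (_ * mzv_trunc_rev _ _ _); lia.
Qed.

(** The star recursion leaves the inner sum at [M.+1], which is the bound of content [p] at this
    stage. *)
Lemma hook_stage_arm M p q : hook_stage M (n + p.+1).+1 p.+1 q =
  hook_stage M (n + p.+1) p.+1 q + npow_neg M.+1 (z p.+1%:Z) * hook_stage M (n + p.+1) p q.
Proof.
rewrite /hook_stage mulr_sumr -big_split /=; apply: eq_bigr => j _.
have -> : (M + (p.+1 + n < (n + p.+1).+1)%N = M.+1)%N by lia.
have -> : (M + (p.+1 + n < n + p.+1)%N = M)%N by lia.
have -> : (n < (n + p.+1).+1 + q)%N = (n < n + p.+1 + q)%N by lia.
by rewrite rev_arm_seqS mzv_trunc_starS; ring.
Qed.

(** The strict recursion leaves the inner sum at [M], and content [-q] is indeed not yet released.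
    The summand [j = q.+1] has an empty leg and is the same at both stages. *)
Lemma hook_stage_leg M t p q : (t + q.+1)%N = n -> hook_stage M t.+1 p q.+1 =
  hook_stage M t p q.+1 + npow_neg M.+1 (z (- q.+1%:Z)) * hook_stage M t p q.
Proof.
move=> tq; rewrite /hook_stage mulr_sumr !(big_nat_recr q.+1) //= leg_seqnn.
have -> : (M + (p + n < t.+1)%N = M)%N by lia.
have -> : (M + (n < t.+1 + q.+1)%N = M.+1)%N by lia.
have -> : (M + (n < t + q.+1)%N = M)%N by lia.
have -> : (M + (n < t + q)%N = M)%N by lia.
have -> : (M + (p + n < t)%N = M)%N by lia.
rewrite addrAC -big_split /=; congr (_ + _); rewrite !big_nat.
by apply: eq_bigr => j /andP[_ jq]; rewrite rev_leg_seqS // mzv_trunc_strictS; ring.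
Qed.

(** Removing [z 0] from the star factors leaves an alternating sum with both bounds [M.+1], which
    orthogonality evaluates. *)
Lemma hook_stage_diag M q : hook_stage M n.+1 0 q =
  hook_stage M n 0 q + npow_neg M.+1 (z 0) * (q == 0%N)%:R.
Proof.
have := star_strict_orthogonal _ M.+1 [seq z (- x%:Z) | x <- iota 1 q].
have -> : ([seq z (- x%:Z) | x <- iota 1 q] == [::]) = (q == 0)%N by case: q.
move=> <-; rewrite /hook_stage mulr_sumr size_map size_iota -big_split /= !big_nat.
apply: eq_bigr => j /andP[_ jq].
have -> : (M + (0 + n < n.+1)%N = M.+1)%N by lia.
have -> : (M + (0 + n < n)%N = M)%N by lia.
have -> : (M + (n < n.+1 + q)%N = M.+1)%N by lia.
rewrite rev_arm_seq0 mzv_trunc_starS -map_take take_iota -map_drop drop_iota add1n.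
have -> : minn j q = j by lia.
rewrite -/(leg_seq q j).
(* For a nonempty leg, content [-q] was released earlier, so its bound is already [M.+1]; for
   [q = 0] the strict list is empty. *)
case: q jq => [|q] jq.
  by rewrite /leg_seq sub0n; ring.
have -> : (M + (n < n + q.+1)%N = M.+1)%N by lia.
ring.
Qed.

End Hook.

(** * Frobenius coordinates of a partition and the identity at level [M] *)

Section TruncatedGiambelli.
Variables (R : realType) (la : seq nat) (z : int -> R[i]).
Hypothesis la_part : is_partition la.

(** With [K = M] the entries are at most [M] by their type, so the staging condition is vacuous. *)
Lemma schur_zeta_truncE M :
  schur_zeta_trunc la (fun i j : nat => z (j%:Z - i%:Z)) M =
  tabsum _ (fun v c => npow_neg v (z c)) (size la) (head 0%N la) M (in_shape la) M 0.
Proof.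
apply: eq_bigl => T; rewrite [RHS]andb_idr // => _.
apply/staged_of_le => i j; rewrite /stage_bound.
by apply: leq_trans (leq_addr _ _); rewrite -ltnS.
Qed.

Lemma in_shape_mono i j i' j' : (i' <= i)%N -> (j' <= j)%N -> in_shape la i j -> in_shape la i' j'.
Proof.
rewrite /in_shape => ii' jj' lt; apply: leq_ltn_trans jj' (leq_trans lt _).
case/andP: la_part => so _; have [sz|sz] := ltnP i (size la); last by rewrite nth_default.
apply: (sorted_leq_nth _ _ 0%N so) => //; rewrite ?inE //; last exact: leq_ltn_trans ii' sz.
by move=> a b c; lia.
Qed.

(** A downward closed predicate holds on an initial segment whose length is the count. This turns
    bounds by [diag_len] and [conj_part] into membership in the shape. *)
Lemma count_initial (P : pred nat) N i : (forall a b, (a <= b)%N -> P b -> P a) ->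
  (i < count P (iota 0 N))%N = P i && (i < N)%N.
Proof.
move=> Pd; elim: N i => [|N IH] i; first by rewrite andbF.
rewrite -[in iota _ _]addn1 iotaD count_cat /= add0n addn0.
case PN: (P N); last first.
  rewrite addn0 IH ltnS [in RHS]leq_eqVlt; have [->|//] := eqVneq i N.
  by rewrite PN.
have P_le a : (a <= N)%N -> P a by move/Pd; apply.
have -> : count P (iota 0 N) = N.
  apply/eqP; rewrite eqn_leq leqNgt IH ltnn andbF /= leqNgt.
  by apply/negP => cN; have := IH (count P (iota 0 N)); rewrite ltnn cN P_le // ltnW.
by rewrite addn1; case: ltnP => [/P_le->|]; rewrite ?andbF.
Qed.

Lemma in_shape_size i j : in_shape la i j -> (i < size la)%N && (j < head 0 la)%N.
Proof.
move=> ij; have := in_shape_mono i j 0 j (leq0n _) (leqnn _) ij.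
rewrite /in_shape nth0 => ->; rewrite andbT ltnNge; apply/negP => l.
by move: ij; rewrite /in_shape nth_default.
Qed.

Lemma lt_diag_len i : (i < diag_len la)%N = in_shape la i i.
Proof.
rewrite count_initial; last by move=> a b ab; apply: in_shape_mono.
by apply: andb_idr => /in_shape_size/andP[].
Qed.

Lemma lt_conj_part i j : (i < conj_part la j)%N = in_shape la i j.
Proof.
have -> : conj_part la j = count (in_shape la ^~ j) (iota 0 (size la)).
  by rewrite /conj_part -[in LHS](mkseq_nth 0%N la) count_map.
rewrite count_initial; last by move=> a b ab; apply: in_shape_mono.
by apply: andb_idr => /in_shape_size/andP[].
Qed.

Lemma frob_shapeE : in_shape la =2 frob_shape (diag_len la) (frob_p la) (frob_q la).
Proof.
move=> i j; rewrite /frob_shape !lt_diag_len /frob_p /frob_q; case: ifP => ij.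
  rewrite -[nth 0%N la i]/(nth 0%N la i) /in_shape; lia.
rewrite -!lt_conj_part; lia.
Qed.

Lemma frob_p_decreasing : decreasing_upto (diag_len la) (frob_p la).
Proof.
move=> i j ij; rewrite lt_diag_len /frob_p => jj.
have le : (nth 0 la j <= nth 0 la i)%N.
  rewrite leqNgt; apply/negP => l.
  by have := in_shape_mono j (nth 0%N la i) i _ (ltnW ij) (leqnn _) l; rewrite /in_shape ltnn.
by move: jj; rewrite /in_shape; lia.
Qed.

Lemma frob_q_decreasing : decreasing_upto (diag_len la) (frob_q la).
Proof.
move=> i j ij; rewrite lt_diag_len -lt_conj_part /frob_q => jj.
have le : (conj_part la j <= conj_part la i)%N.
  rewrite leqNgt; apply/negP; rewrite lt_conj_part => /(in_shape_mono _ _ _ i (leqnn _) (ltnW ij)).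
  by rewrite -lt_conj_part ltnn.
lia.
Qed.

Lemma frob_bounds i : (i < diag_len la)%N ->
  (frob_p la i + i < head 0 la)%N && (frob_q la i + i < size la)%N.
Proof.
rewrite lt_diag_len => ii; apply/andP; split.
  have : in_shape la i (nth 0%N la i).-1 by move: ii; rewrite /in_shape; lia.
  by move/in_shape_size => /andP[_]; rewrite /frob_p; move: ii; rewrite /in_shape; lia.
move: (ii); rewrite -lt_conj_part => ci.
have : in_shape la (conj_part la i).-1 i by rewrite -lt_conj_part; lia.
by move/in_shape_size => /andP[+ _]; rewrite /frob_q; lia.
Qed.

Lemma schur_zeta_trunc_det M :
  schur_zeta_trunc la (fun i j : nat => z (j%:Z - i%:Z)) M =
  \det (\matrix_(i < diag_len la, j < diag_len la)
    hook_stage R z (size la) M 0 (frob_p la i) (frob_q la j)).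
Proof.
rewrite schur_zeta_truncE (eq_tabsum _ _ _ _ _ _ _ _ _ frob_shapeE).
apply: staged_giambelli => //.
- exact: hook_stage00.
- exact: hook_stage_last.
- exact: hook_stage_same.
- exact: hook_stage_arm.
- exact: hook_stage_leg.
- exact: hook_stage_diag.
- exact: frob_p_decreasing.
- exact: frob_q_decreasing.
- exact: frob_bounds.
Qed.

Lemma schur_zeta_trunc_giambelli M :
  schur_zeta_trunc la (fun i j : nat => z (j%:Z - i%:Z)) M =
  \sum_(sigma : 'S_(diag_len la))
    (-1) ^+ odd_perm sigma *
    \sum_(jj : {ffun 'I_(diag_len la) -> 'I_(size la)} |
            [forall k, (jj k <= frob_q la k)%N])
      ((-1) ^+ (\sum_(k < diag_len la) (jj k : nat))%N *
       (\prod_(k < diag_len la)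
          mzv_trunc_rev false (rev [seq z (x%:Z - (jj k : nat)%:Z)
                   | x <- iota 0 ((jj k : nat) + frob_p la (sigma k)).+1]) M) *
       (\prod_(k < diag_len la)
          mzv_trunc_rev true
            (rev [seq z (- x%:Z) | x <- iota (jj k : nat).+1 (frob_q la k - jj k)]) M)).
Proof.
(* After transposition the permutation acts on the arm index, giving [p_{sigma(k)}]. *)
rewrite schur_zeta_trunc_det -det_tr; apply: eq_bigr => s _; congr (_ * _).
transitivity (\prod_(k < diag_len la) \sum_(j < size la | (j <= frob_q la k)%N)
  (-1) ^+ j * mzv_trunc_rev false (rev (arm_seq R z (frob_p la (s k)) j)) M *
  mzv_trunc_rev true (rev (leg_seq R z (frob_q la k) j)) M).
  apply: eq_bigr => k _; rewrite !mxE /hook_stage ltn0 addn0 big_mkord.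
  (* Since [q_k < size la], the type ['I_(size la)] contains every [j <= q_k]. *)
  have /andP[_ qn] := frob_bounds k (ltn_ord k).
  rewrite (big_ord_widen_cond (size la) xpredT (fun j => (-1) ^+ j *
    mzv_trunc_rev false (rev (arm_seq R z (frob_p la (s k)) j)) M *
    mzv_trunc_rev true (rev (leg_seq R z (frob_q la k) j)) (M + _))); last by lia.
  apply: eq_big => // j _; congr (_ * mzv_trunc_rev _ _ _); lia.
rewrite bigA_distr_big_dep; apply: eq_big => [f|f _]; last first.
  by rewrite -prodrXr -!big_split.
by apply/familyP/forallP.
Qed.

End TruncatedGiambelli.

(** * Convergence *)

Section Convergence.
Local Open Scope classical_set_scope.
Variable R : realType.
Local Notation normc := (@ComplexField.Normc.normc R).

(** Both [e] and [v + e] are nonincreasing and bounded below, the latter because [v - e] is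
    nondecreasing; [v] is their difference. *)
Lemma cvgn_telescope (v e : nat -> R) : (forall k, 0 <= e k) ->
  (forall k, `|v k.+1 - v k| <= e k - e k.+1) -> cvgn v.
Proof.
move=> e0 ve.
have eD : nonincreasing_seq e.
  by apply/nonincreasing_seqP => k; have := ve k; have := normr_ge0 (v k.+1 - v k); lra.
have ce : cvgn e.
  by apply: nonincreasing_is_cvgn => //; exists 0 => _ [k _ <-].
have cve : cvgn (v + e).
  apply: nonincreasing_is_cvgn.
    by apply/nonincreasing_seqP => k; rewrite !fctE; have := ve k; rewrite ler_norml; lra.
  exists (v 0%N - e 0%N) => _ [k _ <-]; rewrite !fctE.
  suff : v 0%N - e 0%N <= v k - e k by have := e0 k; lra.
  elim: k => // k IH; apply: le_trans IH _; have := ve k; rewrite ler_norml; lra.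
have -> : v = (v + e) - e by rewrite addrK.
exact: is_cvgB.
Qed.

Lemma cvgn_complex (u : nat -> R[i]) (a b : R) :
  complex.Re (u k) @[k --> \oo] --> a -> complex.Im (u k) @[k --> \oo] --> b -> u @ \oo --> a +i* b.
Proof.
move=> ua ub; apply/(@cvgrPdist_lt _ (R[i]^o)) => eps.
(* Distances take values in [R[i]], where a positive [eps] has zero imaginary part. *)
rewrite ltcE /= => /andP[/eqP eI eR].
have e2 : 0 < complex.Re eps / 2 by rewrite divr_gt0.
move/cvgrPdist_lt: ua => /(_ _ e2) ua; move/cvgrPdist_lt: ub => /(_ _ e2) ub.
near=> k.
have ha : `|a - complex.Re (u k)| < complex.Re eps / 2 by near: k.
have hb : `|b - complex.Im (u k)| < complex.Re eps / 2 by near: k.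
rewrite normc_def ltcE /= eI eqxx /=.
move: ha hb; case: (u k) => x y /= ha hb.
apply: (@le_lt_trans _ _ (`|a - x| + `|b - y|)); last by lra.
rewrite -[leRHS]ger0_norm ?addr_ge0 // -sqrtr_sqr ler_wsqrtr //.
rewrite [leRHS]sqrrD !real_normK ?num_real // lerD2r lerDl.
by rewrite mulrn_wge0 // mulr_ge0.
Unshelve. all: by end_near.
Qed.

Lemma normc_ge0 (x : R[i]) : 0 <= normc x.
Proof. by case: x => a b; exact: sqrtr_ge0. Qed.

Lemma normRe_le_normc (x : R[i]) : `|complex.Re x| <= normc x.
Proof. by case: x => a b /=; rewrite -sqrtr_sqr ler_wsqrtr // lerDl sqr_ge0. Qed.

Lemma normIm_le_normc (x : R[i]) : `|complex.Im x| <= normc x.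
Proof. by case: x => a b /=; rewrite -sqrtr_sqr ler_wsqrtr // lerDr sqr_ge0. Qed.

Lemma cvgn_complex_telescope (u : nat -> R[i]) (e : nat -> R) : (forall k, 0 <= e k) ->
  (forall k, normc (u k.+1 - u k) <= e k - e k.+1) -> cvgn u.
Proof.
move=> e0 ue.
have cRe : cvgn (fun k => complex.Re (u k)).
  apply: (cvgn_telescope _ e) => // k; apply: le_trans (ue k).
  by apply: le_trans (normRe_le_normc _); rewrite raddfB.
have cIm : cvgn (fun k => complex.Im (u k)).
  apply: (cvgn_telescope _ e) => // k; apply: le_trans (ue k).
  by apply: le_trans (normIm_le_normc _); rewrite raddfB.
exact: cvgP (cvgn_complex _ _ _ cRe cIm).
Qed.

Lemma normc_npow_neg n (s : R[i]) :
  normc (npow_neg n s) = expR (- complex.Re s * ln n%:R).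
Proof.
rewrite /npow_neg /= sqrrN !exprMn -mulrDr cos2Dsin2 mulr1.
by rewrite sqrtr_sqr ger0_norm ?expR_ge0.
Qed.

(** The shift gives [L 0 = 0] and makes [L M] the logarithm of the index [M.+1] added in passing
    from [M] to [M.+1]. *)
Let L k : R := ln k.+1%:R.

Let L_ge0 k : 0 <= L k. Proof. by rewrite ln_ge0 // ler1n. Qed.

Let expRL k : expR (- L k) = k.+1%:R^-1.
Proof. by rewrite expRN lnK // posrE. Qed.

Let L_step k : k.+2%:R^-1 <= L k.+1 - L k.
Proof.
have u1 : k.+2%:R^-1 < 1 :> R by rewrite invf_lt1 ?ltr1n.
have -> : L k.+1 - L k = - ln (1 + - k.+2%:R^-1).
  have -> : 1 + - k.+2%:R^-1 = k.+1%:R / k.+2%:R :> R.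
    have : k.+1%:R + 1 != 0 :> R by rewrite natr1 pnatr_eq0.
    by rewrite -[k.+2%:R]natr1; move: k.+1%:R => a a0; field.
  by rewrite ln_div ?posrE // opprB.
by rewrite lerNr le_ln1Dx // ltrN2.
Qed.

Let L_step2 k : L k.+1 - L k <= ln 2.
Proof.
rewrite lerBlDl /L -lnM ?posrE // ler_ln ?posrE ?mulr_gt0 //.
by rewrite -natrM ler_nat; lia.
Qed.

(* With [n = k + 2], the next two bounds compare [n^(eps-1)] with [n^eps - (n-1)^eps] and
   [n^(-eps-1)] with [(n-1)^(-eps) - n^(-eps)], so that sums can be bounded by telescoping. *)
Let expR_ln_gap (eps : R) k : 0 < eps ->
  eps * k.+2%:R^-1 * expR (eps * L k.+1) <= (1 + eps) * (expR (eps * L k.+1) - expR (eps * L k)).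
Proof.
move=> e0; set u := k.+2%:R^-1; set E := expR (eps * L k.+1); set F := expR (eps * L k).
have u0 : 0 <= u by rewrite invr_ge0.
have u1 : u <= 1 by rewrite invf_le1 ?ler1n.
have F0 : 0 < F := expR_gt0 _.
have EF : F * (1 + eps * u) <= E.
  have -> : E = F * expR (eps * (L k.+1 - L k)) by rewrite -expRD; congr expR; ring.
  rewrite ler_pM2l //; apply: le_trans (expR_ge1Dx _).
  by rewrite lerD2l ler_pM2l // L_step.
have eu : 0 <= eps * u by rewrite mulr_ge0 // ltW.
have EF0 : 0 <= E - F by nra.
(* Write [eps u E] as [eps u F + eps u (E - F)]: the first term is at most [E - F] by [EF], the
   second at most [eps (E - F)]. *)
have : 0 <= (E - F) * (eps - eps * u) by rewrite mulr_ge0 // subr_ge0 ler_piMr // ltW.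
lra.
Qed.

Let expRN_ln_gap (eps : R) k : 0 < eps ->
  eps * k.+2%:R^-1 * expR (- eps * L k.+1) <= expR (- eps * L k) - expR (- eps * L k.+1).
Proof.
move=> e0; have -> : expR (- eps * L k) = expR (- eps * L k.+1) * expR (eps * (L k.+1 - L k)).
  by rewrite -expRD; congr expR; ring.
rewrite lerBrDr -[X in _ + X]mul1r -mulrDl mulrC ler_pM2l ?expR_gt0 //.
by apply: le_trans (expR_ge1Dx _); rewrite addrC lerD2l ler_pM2l // L_step.
Qed.

Lemma mzv_trunc_consS b (x : R[i]) s M : mzv_trunc_rev b (x :: s) M.+1 =
  mzv_trunc_rev b (x :: s) M + npow_neg M.+1 x * mzv_trunc_rev b s (if b then M else M.+1).
Proof. by case: b; rewrite ?mzv_trunc_strictS ?mzv_trunc_starS. Qed.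

Let L_mono k : L k <= L k.+1.
Proof. by rewrite ler_ln ?posrE // ler_nat. Qed.

(** Real parts at least 1 allow at most logarithmic growth, which any power [eps] dominates. The
    same [eps] survives each nested summation, because summing [n^(eps-1)] gives back a multiple of
    [n^eps]. *)
Lemma mzv_trunc_growth b (s : seq R[i]) (eps : R) : 0 < eps ->
  (forall x, x \in s -> 1 <= complex.Re x) ->
  exists2 C, 0 <= C & forall M, normc (mzv_trunc_rev b s M) <= C * expR (eps * L M).
Proof.
move=> e0; elim: s => [|x s IH] s1.
  exists 1 => // M; rewrite mul1r ComplexField.Normc.normc1.
  by rewrite -expR0 ler_expR mulr_ge0 // ltW.
have [|C C0 HC] := IH; first by move=> y ys; apply: s1; rewrite inE ys orbT.
have x1 : 1 <= complex.Re x by apply: s1; rewrite inE eqxx.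
(* The factor 2 comes from [1/(M+1) <= 2/(M+2)], the factor [(1 + eps) / eps] from [expR_ln_gap]. *)
pose C' := 2 * C * (1 + eps) / eps.
have C'0 : 0 <= C' by rewrite divr_ge0 ?mulr_ge0 ?addr_ge0 // ltW.
exists C' => // M.
(* Subtracting 1 makes the bound vanish at [M = 0], where the telescoping starts. *)
suff : normc (mzv_trunc_rev b (x :: s) M) <= C' * (expR (eps * L M) - 1) by lra.
elim: M => [|M IHM].
  by rewrite mzv_trunc0 ComplexField.Normc.normc0 /L ln1 mulr0 expR0 subrr mulr0.
rewrite mzv_trunc_consS; apply: le_trans (le_normcD _ _) _.
have -> : C' * (expR (eps * L M.+1) - 1) = C' * (expR (eps * L M) - 1)
  + C' * (expR (eps * L M.+1) - expR (eps * L M)) by ring.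
apply: lerD => //; rewrite ComplexField.Normc.normcM normc_npow_neg.
have inner : normc (mzv_trunc_rev b s (if b then M else M.+1)) <= C * expR (eps * L M.+1).
  by apply: le_trans (HC _) _; rewrite ler_wpM2l // ler_expR ler_pM2l //; case: (b).
have weight : expR (- complex.Re x * L M) <= 2 * M.+2%:R^-1.
  apply: (@le_trans _ _ (expR (- L M))).
    by rewrite ler_expR mulNr lerN2 ler_peMl.
  rewrite expRL -[2 * _]invrK lef_pV2 ?posrE ?invr_gt0 ?mulr_gt0 ?invr_gt0 //.
  rewrite invfM invrK ler_pdivrMl // -natrM ler_nat; lia.
apply: le_trans (ler_pM (expR_ge0 _) _ weight inner) _; first exact: normc_ge0.
have -> : 2 * M.+2%:R^-1 * (C * expR (eps * L M.+1)) =
  2 * C / eps * (eps * M.+2%:R^-1 * expR (eps * L M.+1)).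
  by move: (M.+2%:R^-1) => u; field; rewrite gt_eqF.
have -> : C' * (expR (eps * L M.+1) - expR (eps * L M)) =
  2 * C / eps * ((1 + eps) * (expR (eps * L M.+1) - expR (eps * L M))).
  by rewrite /C'; ring.
by rewrite ler_wpM2l ?expR_ln_gap // divr_ge0 ?mulr_ge0 // ltW.
Qed.

Lemma cvgn_mzv_trunc b (x : R[i]) s : 1 < complex.Re x ->
  (forall y, y \in s -> 1 <= complex.Re y) -> cvgn (mzv_trunc_rev b (x :: s)).
Proof.
move=> x1 s1.
(* Half of the excess of the real part over 1 absorbs the growth [n^eps] of the inner sum; the other
   half leaves summable terms of order [n^(-1-eps)]. *)
have [eps e0 xE] : exists2 eps : R, 0 < eps & complex.Re x = 1 + 2 * eps.
  by exists ((complex.Re x - 1) / 2); [rewrite divr_gt0 // subr_gt0|field].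
have [C C0 HC] := mzv_trunc_growth b s eps e0 s1.
(* The power of 2 passes from the base [k+1] to [k+2] in the weight, and the division by [eps] comes
   from [expRN_ln_gap]. *)
pose B := C * expR ((1 + 2 * eps) * ln 2) / eps.
have B0 : 0 <= B by rewrite divr_ge0 ?mulr_ge0 ?expR_ge0 // ltW.
apply: (cvgn_complex_telescope _ (fun k => B * expR (- eps * L k))) => k.
  by rewrite mulr_ge0 ?expR_ge0.
rewrite mzv_trunc_consS addrAC subrr add0r ComplexField.Normc.normcM normc_npow_neg xE.
have inner : normc (mzv_trunc_rev b s (if b then k else k.+1)) <= C * expR (eps * L k.+1).
  by apply: le_trans (HC _) _; rewrite ler_wpM2l // ler_expR ler_pM2l //; case: (b).
have weight : expR (- (1 + 2 * eps) * L k) <=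
    expR ((1 + 2 * eps) * ln 2) * expR (- (1 + 2 * eps) * L k.+1).
  by rewrite -expRD ler_expR; have := L_step2 k; nra.
apply: le_trans (ler_pM (expR_ge0 _) _ weight inner) _; first exact: normc_ge0.
rewrite -mulrBr; apply: (le_trans _ (ler_wpM2l B0 (expRN_ln_gap eps k e0))).
rewrite -expRL.
have -> : - (1 + 2 * eps) * L k.+1 = - L k.+1 + (- eps * L k.+1) - eps * L k.+1 by ring.
rewrite !expRD [expR (- (eps * _))]expRN /B le_eqVlt; apply/orP; left; apply/eqP.
by field; rewrite !gt_eqF ?expR_gt0.
Qed.

End Convergence.

(** * Limits of finite sums and products of complex sequences *)

Section ComplexLimits.
Local Open Scope classical_set_scope.
Variable R : realType.

Lemma cvgn_sum_complex (I : finType) (P : pred I) (f : I -> nat -> R[i]) (l : I -> R[i]) :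
  (forall i, P i -> f i n @[n --> \oo] --> l i) ->
  \sum_(i | P i) f i n @[n --> \oo] --> \sum_(i | P i) l i.
Proof. by move=> fl; apply: cvg_big => //; exact: (@add_continuous R[i]^o). Qed.

Lemma cvgn_prod_complex (I : finType) (P : pred I) (f : I -> nat -> R[i]) (l : I -> R[i]) :
  (forall i, P i -> f i n @[n --> \oo] --> l i) ->
  \prod_(i | P i) f i n @[n --> \oo] --> \prod_(i | P i) l i.
Proof. by move=> fl; apply: cvg_big => //; exact: (@mul_continuous R[i] : continuous _). Qed.

Lemma cvgn_mul_complex (f g : nat -> R[i]) (a b : R[i]) :
  f @ \oo --> a -> g @ \oo --> b -> f n * g n @[n --> \oo] --> a * b.
Proof. by move=> fa gb; exact: (@cvgM R[i] nat \oo _ f g a b fa gb). Qed.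

Lemma limn_complex (f : nat -> R[i]) (a : R[i]) : f @ \oo --> a -> limn f = a.
Proof. by apply: cvg_lim; exact: (@norm_hausdorff _ R[i]^o). Qed.

End ComplexLimits.

Theorem theorem4p1 (R : realType) (la : seq nat) (z : int -> R[i])
  (Hla : is_partition la)
  (Hz : forall i j : nat, in_shape la i j -> 1 <= complex.Re (z (j%:Z - i%:Z)))
  (Hp : forall i : nat, (i < diag_len la)%N -> 1 < complex.Re (z (frob_p la i)%:Z))
  (Hq : forall i : nat, (i < diag_len la)%N -> 1 < complex.Re (z (- (frob_q la i)%:Z))) :
  schur_zeta la (fun i j : nat => z (j%:Z - i%:Z)) =
  \sum_(sigma : 'S_(diag_len la))
    (-1) ^+ odd_perm sigma *
    \sum_(jj : {ffun 'I_(diag_len la) -> 'I_(size la)} |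
            [forall k, (jj k <= frob_q la k)%N])
      ((-1) ^+ (\sum_(k < diag_len la) (jj k : nat))%N *
       (\prod_(k < diag_len la)
          mzv_star [seq z (x%:Z - (jj k : nat)%:Z)
                   | x <- iota 0 ((jj k : nat) + frob_p la (sigma k)).+1]) *
       (\prod_(k < diag_len la)
          mzv [seq z (- x%:Z) | x <- iota (jj k : nat).+1 (frob_q la k - jj k)])).
Proof.
have diag_in i (ii : (i < diag_len la)%N) := frob_bounds la Hla i ii.
have arm_shape i c : (i < diag_len la)%N -> (c <= frob_p la i)%N -> in_shape la i (i + c).
  by move=> ii cp; rewrite (frob_shapeE la Hla) frob_shape_arm ii.
have leg_shape i c : (i < diag_len la)%N -> (c <= frob_q la i)%N -> in_shape la (i + c) i.
  by move=> ii cq; rewrite (frob_shapeE la Hla) frob_shapeC frob_shape_arm ii.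
have Re_arm i c : (i < diag_len la)%N -> (c <= frob_p la i)%N -> 1 <= complex.Re (z c%:Z).
  by move=> ii cp; have := Hz _ _ (arm_shape i c ii cp); rewrite PoszD addrC addKr.
have Re_leg i c : (i < diag_len la)%N -> (c <= frob_q la i)%N -> 1 <= complex.Re (z (- c%:Z)).
  by move=> ii cq; have := Hz _ _ (leg_shape i c ii cq); rewrite PoszD opprD addNKr.
(* The contents in a star list run from [-j] to [p_l]: the nonnegative ones occur in arm [l], the
   negative ones in leg [k]. *)
have Re_mid k l j c : (k < diag_len la)%N -> (l < diag_len la)%N -> (j <= frob_q la k)%N ->
    (c <= j + frob_p la l)%N -> 1 <= complex.Re (z (c%:Z - j%:Z)).
  move=> kN lN jq cj; have [jc|cj'] := leqP j c.
    have -> : c%:Z - j%:Z = (c - j)%:Z by lia.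
    by apply: (Re_arm l) => //; lia.
  have -> : c%:Z - j%:Z = - (j - c)%:Z by lia.
  by apply: (Re_leg k) => //; lia.
have cvg_star (k l : 'I_(diag_len la)) j : (j <= frob_q la k)%N ->
    cvgn (mzv_trunc_rev false (rev (arm_seq R z (frob_p la l) j))).
  move=> jq.
  have arm_Re y : y \in rev (arm_seq R z (frob_p la l) j) -> 1 <= complex.Re y.
    rewrite mem_rev => /mapP[c]; rewrite mem_iota add0n ltnS => /andP[_ cj] ->.
    exact: (Re_mid k l).
  (* The outermost argument is [z_{p_l}], whose real part exceeds 1 by [Hp]; for the strict sums
     below it is [z_{-q_k}], covered by [Hq]. *)
  have [s sE] : exists s, rev (arm_seq R z (frob_p la l) j) = z (frob_p la l)%:Z :: s.
    by case: (frob_p la l) => [|p]; rewrite ?rev_arm_seqS ?rev_arm_seq0; eexists.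
  rewrite sE in arm_Re *; apply: cvgn_mzv_trunc; first exact: Hp.
  by move=> y ys; apply: arm_Re; rewrite inE ys orbT.
have cvg_strict (k : 'I_(diag_len la)) j : (j <= frob_q la k)%N ->
    cvgn (mzv_trunc_rev true (rev (leg_seq R z (frob_q la k) j))).
  move=> jq.
  have leg_Re y : y \in rev (leg_seq R z (frob_q la k) j) -> 1 <= complex.Re y.
    rewrite mem_rev => /mapP[c]; rewrite mem_iota => /andP[jc cj] ->.
    by apply: (Re_leg k) => //; lia.
  move: jq; rewrite leq_eqVlt => /orP[/eqP->|jq].
    by rewrite leg_seqnn; exact: is_cvg_cst.
  have := Hq k (ltn_ord k); move: leg_Re.
  case: (frob_q la k) jq => // q jq; rewrite rev_leg_seqS // => leg_Re qRe.
  apply: cvgn_mzv_trunc => // y ys; apply: leg_Re; rewrite inE ys orbT //.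
(* The truncated identity holds at every level, and its right side is a finite combination of
   convergent factors, so the limit is taken termwise. *)
apply: limn_complex.
rewrite (funext (schur_zeta_trunc_giambelli R la z Hla)).
apply: cvgn_sum_complex => s _; apply: cvgn_mul_complex; first exact: cvg_cst.
apply: cvgn_sum_complex => jj /forallP jjq.
apply: cvgn_mul_complex; first apply: cvgn_mul_complex; first exact: cvg_cst.
- by apply: cvgn_prod_complex => k _; exact: (cvg_star k).
- by apply: cvgn_prod_complex => k _; exact: cvg_strict.
Qed.
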